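(* Let $\mathcal H$ be a real Hilbert space, let $F\colon\mathcal H\to\mathcal H$ be $L$-Lipschitz continuous and $\alpha$-strongly monotone, and let $C\subseteq\mathcal H$ be nonempty, closed and convex. For each $k=0,1,2,\ldots$, let $T_k\colon\mathcal H\to\mathcal H$ be a cutter such that $C\subseteq\operatorname{Fix}T_k$ and let $\lambda_k\in[0,\infty)$. Consider the outer approximation method $$x^0\in\mathcal H;\qquad x^{k+1}:=R_k(x^k-\lambda_kFx^k),\qquad k=0,1,2,\ldots,$$ where $$R_k:=\operatorname{Id}+\alpha_k(P_{H_k}-\operatorname{Id}),\qquad H_k:=\{z\in\mathcal H\mid\langle z-T_kx^k,\,x^k-T_kx^k\rangle\le 0\},$$ and where $\alpha_k\in[\varepsilon,2-\varepsilon]$ is a user-chosen relaxation parameter, for some $\varepsilon>0$. Then: (a) The sequence $\{x^k\}_{k=0}^\infty$ is bounded. (b) Moreover, if $\lim_{k\to\infty}\lambda_k=0$ and there is an integer $s\ge1$ such that the implication $$\lim_{k\to\infty}\sum_{l=0}^{s-1}\|T_{n_k-l}x^{n_k-l}-x^{n_k-l}\|=0\quad\Longrightarrow\quad\lim_{k\to\infty}d(x^{n_k},C)=0$$ holds true for each subsequence $\{n_k\}_{k=0}^\infty\subseteq\{k\}_{k=0}^\infty$, then $\lim_{k\to\infty}d(x^k,C)=0$. (c) If, in addition to the assumptions in (b), $\sum_{k=0}^\infty\lambda_k=\infty$, then the sequence $\{x^k\}_{k=0}^\infty$ converges in norm to the unique solution of VI($F$, $C$).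
   Context: $\langle\cdot,\cdot\rangle$ and $\|\cdot\|$ are the inner product and induced norm of $\mathcal H$; $\operatorname{Id}$ is the identity operator. $F$ is $L$-Lipschitz continuous ($L>0$) if $\|Fx-Fy\|\le L\|x-y\|$ for all $x,y$, and $\alpha$-strongly monotone ($\alpha>0$) if $\langle Fx-Fy,x-y\rangle\ge\alpha\|x-y\|^2$ for all $x,y$. VI($F$, $C$) is the problem: find $x^*\in C$ such that $\langle Fx^*,z-x^*\rangle\ge0$ for all $z\in C$; under the assumptions on $F$ and $C$ it has a unique solution. For an operator $U\colon\mathcal H\to\mathcal H$, $\operatorname{Fix}U:=\{z\in\mathcal H\mid Uz=z\}$. $U$ is a cutter if $\operatorname{Fix}U\ne\emptyset$ and $\langle z-Ux,x-Ux\rangle\le0$ for all $x\in\mathcal H$ and all $z\in\operatorname{Fix}U$. For a nonempty closed convex set $D$, $P_D$ is the metric projection onto $D$, and $d(x,D)=\|P_Dx-x\|$ is the distance from $x$ to $D$. A subsequence $\{n_k\}_{k=0}^\infty\subseteq\{k\}_{k=0}^\infty$ is a strictly increasing sequence of nonnegative integers; terms with negative index $n_k-l$ (which occur for only finitely many $k$) are disregarded.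
   Formalization: Part (a) is false for arbitrary λ_k ≥ 0 (H = ℝ, F = Id, C = {0}, T_k = Id, α_k = 1, λ_k = 3 gives x^k = (−2)^k x^0); boundedness is proved assuming that eventually λ_k ≤ μ for some μ < 2α/L², which lim λ_k = 0 implies. *)

(* Defs.v *)
From HB Require Import structures.
From mathcomp Require Import all_boot all_order all_algebra sesquilinear.
From mathcomp Require Import all_classical all_reals all_analysis.
Set Implicit Arguments.
Unset Strict Implicit.
Unset Printing Implicit Defensive.
Import Order.TTheory GRing.Theory Num.Theory numFieldNormedType.Exports.
Local Open Scope classical_set_scope.
Local Open Scope ring_scope.

(* A real Hilbert space is given by a complete normed space [H] together with a
   symmetric positive definite bilinear form [ip] that induces its norm. *)
Definition induces_norm (R : realType) (H : completeNormedModType R)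
    (ip : {dot H for idfun}) : Prop :=
  forall u : H, `|u| = Num.sqrt (ip u u).

Definition strongly_monotone (R : realType) (H : completeNormedModType R)
    (ip : {dot H for idfun}) (alpha : R) (F : H -> H) : Prop :=
  forall u v : H, alpha * `|u - v| ^+ 2 <= ip (F u - F v) (u - v).

Definition VI_solution (R : realType) (H : completeNormedModType R)
    (ip : {dot H for idfun}) (F : H -> H) (C : set H) (u : H) : Prop :=
  C u /\ forall z : H, C z -> 0 <= ip (F u) (z - u).

Definition Fix (H : Type) (U : H -> H) : set H := [set z | U z = z].

Definition cutter (R : realType) (H : completeNormedModType R)
    (ip : {dot H for idfun}) (U : H -> H) : Prop :=
  Fix U !=set0 /\
  forall u z : H, Fix U z -> ip (z - U u) (u - U u) <= 0.

(* [xget] chooses a nearest point of [D] to [u]; it is unique when [D] is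
   nonempty, closed and convex, the only case in which [P_D] is meaningful. If
   there is no nearest point, the value is the irrelevant default [u]. *)
Definition metric_proj (R : realType) (H : completeNormedModType R)
    (D : set H) (u : H) : H :=
  xget u [set p | D p /\ forall z : H, D z -> `|u - p| <= `|u - z|].

Definition dist (R : realType) (H : completeNormedModType R)
    (u : H) (D : set H) : R :=
  `|metric_proj D u - u|.

Definition cut_halfspace (R : realType) (H : completeNormedModType R)
    (ip : {dot H for idfun}) (U : H -> H) (u : H) : set H :=
  [set z | ip (z - U u) (u - U u) <= 0].

Definition relaxed_proj (R : realType) (H : completeNormedModType R)
    (a : R) (D : set H) (u : H) : H :=
  u + a *: (metric_proj D u - u).

(* Terms with index [n k - l < 0] are dropped from the sum by its condition, so
   the truncated subtraction is never reached outside its range. *)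
Definition residual_sum (R : realType) (H : completeNormedModType R)
    (T : nat -> H -> H) (x : nat -> H) (s : nat) (n : nat -> nat) (k : nat) : R :=
  \sum_(l < s | (l <= n k)%N)
    `|T (n k - l)%N (x (n k - l)%N) - x (n k - l)%N|.

(* Main.v *)
Require Import Defs.
From mathcomp Require Import all_boot all_order all_algebra sesquilinear.
From mathcomp Require Import all_classical all_reals all_analysis.
From mathcomp Require Import ring lra zify.
Set Implicit Arguments.
Unset Strict Implicit.
Unset Printing Implicit Defensive.
Import Order.TTheory GRing.Theory Num.Theory numFieldNormedType.Exports.
Local Open Scope classical_set_scope.
Local Open Scope ring_scope.

(** Write y_k = x_k - lambda_k F(x_k), let r_k be the distance from y_k to the
    half-space H_k, and let d_k be the distance from x_k to C.  A point fixed by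
    the cutter T_k lies in H_k, so C is contained in H_k and a relaxed projection
    onto H_k takes y_k no farther from any z in C; quantitatively
    ([cutter_step_decrease]),
      |x_{k+1} - z|^2 <= |y_k - z|^2 - eps^2 r_k^2.
    Everything follows from this inequality for different choices of z.

    Boundedness.  When 0 <= lambda <= mu < 2 alpha / L^2, the map
    u |-> u - lambda F(u) shrinks distances by the factor 1 - lambda c / 2, where
    c = 2 alpha - mu L^2.  It displaces z by lambda |F(z)|, so it preserves every
    ball around z whose radius is large compared with |F(z)|
    ([gradient_step_ball]).

    Distance to C.  Take z = P_C(x_k).  As all sequences are bounded and
    lambda_k --> 0,
      d_{k+1}^2 <= d_k^2 - eps^2 r_k^2 + e_k  with  e_k --> 0.
    The regularity hypothesis on subsequences has a uniform form
    ([uniform_of_subsequential]): if d_k is not small, one of the residuals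
    |T_m x_m - x_m| in the window k-s < m <= k is bounded below, and so is r_m,
    because |T_m x_m - x_m| <= |y_m - x_m| + r_m ([cutter_residual_le]).  Over
    that window the square of the distance then drops by a fixed amount, since
    the errors e_k are eventually negligible.  A bounded sequence cannot drop by
    a fixed amount forever, hence d_k --> 0 ([quasi_decreasing_cvg0]).

    Convergence.  The solution xs of the variational inequality is the fixed
    point of the contraction u |-> P_C(u - (alpha / L^2) F(u)).  Take z = xs.
    Strong monotonicity and
      <F(xs), x_k - xs> >= <F(xs), x_k - P_C(x_k)> >= - |F(xs)| d_k
    give
      |x_{k+1} - xs|^2 <= (1 - 2 alpha lambda_k) |x_k - xs|^2 + lambda_k beta_k
    with beta_k --> 0, and the divergence of the series of the lambda_k forces
    |x_k - xs| --> 0 ([contracted_recursion_cvg0]).  The bound on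
    <F(xs), x_k - xs> is what makes d_k --> 0 sufficient, with no recourse to
    weak cluster points. *)

(** * Recursive inequalities between real sequences *)

Section RealSequences.
Context (R : realType).
Implicit Types (D r e t d lam beta S : nat -> R).

Lemma bounded_of_eventually (V : normedModType R) (u : nat -> V) (B : R) :
  (\forall k \near \oo, `|u k| <= B) -> exists M, forall k, `|u k| <= M.
Proof.
move=> [N _ uB]; exists (B + \sum_(i < N) `|u i|) => k.
have s0 : 0 <= \sum_(i < N) `|u i| by exact: sumr_ge0.
have [Nk|kN] := leqP N k; first by rewrite ler_wpDr//; exact: uB.
have B0 : 0 <= B by apply: le_trans (uB N (leqnn N)).
rewrite ler_wpDl// (bigD1 (Ordinal kN))//= lerDl.
exact: sumr_ge0.
Qed.

(** Were there no threshold delta, one could pick ever larger indices at which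
    t is below 1/(j+1) while d stays above eta; these indices form a subsequence
    that contradicts the hypothesis. *)
Lemma uniform_of_subsequential t d :
    (forall k, 0 <= t k) ->
    (forall n : nat -> nat, increasing_seq n ->
       t (n k) @[k --> \oo] --> (0 : R) -> d (n k) @[k --> \oo] --> (0 : R)) ->
  forall eta, 0 < eta ->
    exists2 delta, 0 < delta & \forall k \near \oo, t k <= delta -> d k <= eta.
Proof.
move=> t0 reg eta eta0; apply: contrapT => nreg.
have bad j N : exists k, [/\ (N <= k)%N, t k <= j.+1%:R^-1 & eta < d k].
  apply: contrapT => nbad; apply: nreg; exists j.+1%:R^-1.
    by rewrite invr_gt0.
  exists N => // k /= Nk tk; rewrite leNgt; apply/negP => dk.
  by apply: nbad; exists k.
have /choice[f fP] : forall jN : nat * nat, exists k,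
  [/\ (jN.2 <= k)%N, t k <= jN.1.+1%:R^-1 & eta < d k].
  by move=> [j N]; exact: bad.
pose n := fix n j := if j is i.+1 then f (j, (n i).+1) else f (0%N, 0%N).
have nP j : t (n j) <= j.+1%:R^-1 /\ eta < d (n j).
  case: j => [|j] /=; first by case: (fP (0%N, 0%N)).
  by case: (fP (j.+1, (n j).+1)).
have nt j : t (n j) <= j.+1%:R^-1 by case: (nP j).
have nd j : eta < d (n j) by case: (nP j).
have ninc : increasing_seq n.
  apply: le_mono; apply: (@homo_ltn _ n (fun i j => (i < j)%O)) => [b i j|i].
    exact: lt_trans.
  by rewrite /=; case: (fP (i.+1, (n i).+1)).
have tn0 : t (n k) @[k --> \oo] --> (0 : R).
  apply: (squeeze_cvgr _ (cvg_cst (0 : R)) (@cvg_harmonic R)).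
  by near=> k; rewrite t0 nt.
have /cvgr0Pnorm_lt/(_ _ eta0)[N _ /(_ N (leqnn N))] := reg n ninc tn0.
by move=> /= /(le_lt_trans (ler_norm _)); rewrite ltNge (ltW (nd N)).
Unshelve. all: by end_near. Qed.

(** Each further block of s indices either brings D below eta or costs it at
    least rho, so after j blocks D is at most the larger of eta and B - j rho. *)
Lemma eventually_le_of_drop D s eta rho B : 0 < rho ->
    (forall k, D k <= B) ->
    (\forall k \near \oo, D k.+1 <= eta \/ D k.+1 <= D (k.+1 - s)%N - rho) ->
  \forall k \near \oo, D k <= eta.
Proof.
move=> rho0 DB [N _ drop].
have bnd j : forall k, (N.+1 + j * s <= k)%N ->
    D k <= eta \/ D k <= B - j%:R * rho.
  elim: j => [|j IH] [|k] Nk; [by right; rewrite mul0r subr0| | |].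
  - by right; rewrite mul0r subr0.
  - by move: Nk; rewrite addSn ltn0.
  have [|Dk|Dk] := drop k; [by rewrite /=; lia|by left|].
  (* if the value s steps earlier was already below eta, the drop keeps it
     there *)
  have [|Dks|Dks] := IH (k.+1 - s)%N; first by lia.
    by left; lra.
  by right; rewrite -natr1; lra.
have [j jP] : exists j : nat, (B - eta) / rho <= j%:R.
  by exists (Num.truncn ((B - eta) / rho)).+1; apply/ltW/truncnS_gt.
exists (N.+1 + j * s)%N => // k /= /bnd[//|Dk]; apply: le_trans Dk _.
by move: jP; rewrite ler_pdivrMr//; lra.
Qed.

(** A window of length s containing one decrease of size sigma loses more than
    the other steps of the window can gain, once the errors e are below a
    small fraction om of sigma: the net loss is at least om. *)
Lemma quasi_decreasing_cvg0 D r e s B :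
    (forall k, 0 <= D k <= B) -> (forall k, 0 <= r k) ->
    e k @[k --> \oo] --> (0 : R) ->
    (\forall k \near \oo, D k.+1 <= D k - r k + e k) ->
    (forall eta, 0 < eta -> exists2 sigma, 0 < sigma &
       \forall k \near \oo, D k <= eta \/
         exists l, [/\ (l < s)%N, (l <= k)%N & sigma <= r (k - l)%N]) ->
  D k @[k --> \oo] --> (0 : R).
Proof.
move=> DB r0 e0 [N1 _ desc] drop; apply/cvgr0Pnorm_le => eta eta0.
have eta20 : 0 < eta / 2 by rewrite divr_gt0.
have [sigma sigma0 [N2 _ dropN]] := drop _ eta20.
(* om <= eta / 2 lets D leave the level eta / 2 without passing eta in one step;
   2 (s + 1) om <= sigma lets one decrease outweigh s errors with om to spare *)
pose om := Num.min (eta / 2) (sigma / (2 * s.+1%:R)).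
have om0 : 0 < om by rewrite lt_min eta20 divr_gt0// mulr_gt0.
have ometa : om <= eta / 2 by rewrite ge_min lexx.
have oms : 2 * s.+1%:R * om <= sigma.
  by rewrite mulrC -ler_pdivlMr ?mulr_gt0// ge_min lexx orbT.
have [N3 _ eN] : \forall k \near \oo, `|e k| <= om by move/cvgr0Pnorm_le: e0; apply.
pose N := maxn N1 (maxn N2 N3).
have e_om k : (N <= k)%N -> e k <= om.
  by move=> Nk; apply: le_trans (ler_norm _) _; apply: eN; rewrite /=; lia.
have descN k : (N <= k)%N -> D k.+1 <= D k - r k + e k.
  by move=> Nk; apply: desc; rewrite /=; lia.
have climb k j : (N <= k)%N -> D (k + j)%N <= D k + j%:R * om.
  move=> Nk; elim: j => [|j IH]; first by rewrite addn0 mul0r addr0.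
  have Nkj : (N <= k + j)%N by lia.
  rewrite addnS -natr1; have := descN _ Nkj; have := e_om _ Nkj.
  have := r0 (k + j)%N; lra.
have ev : \forall k \near \oo, D k <= eta.
  apply: (@eventually_le_of_drop D s eta om B) => //.
    by move=> k; case/andP: (DB k).
  exists (N + s)%N => // k /= Nk.
  have [|Dk|[l [ls lk sr]]] := dropN k; first by rewrite /=; lia.
    left; have Nk' : (N <= k)%N by lia.
    have := descN _ Nk'; have := e_om _ Nk'; have := r0 k; lra.
  (* split the window at k - l: at most s - l - 1 errors before, the decrease
     itself, at most l errors after *)
  right; have Nkl : (N <= k - l)%N by lia.
  have := descN _ Nkl; have := e_om _ Nkl.
  have := climb (k - l).+1 l; have := climb (k.+1 - s)%N (s - l.+1)%N.
  have -> : (k.+1 - s + (s - l.+1))%N = (k - l)%N by lia.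
  have -> : ((k - l).+1 + l)%N = k.+1 by lia.
  have -> : (s - l.+1)%:R = s%:R - l%:R - 1 :> R.
    by rewrite natrB// -natr1; lra.
  move=> /(_ ltac:(lia)) h1 /(_ ltac:(lia)) h2 h3 h4.
  move: oms; rewrite -natr1 => oms.
  have : 0 <= s%:R * om by rewrite mulr_ge0// ltW.
  nra.
near=> k; rewrite ger0_norm; last by case/andP: (DB k).
by near: k.
Unshelve. all: by end_near. Qed.

(** As long as S stays above eta, it falls at step k by at least g lam_k; the
    divergent series exhausts S after finitely many steps.  Once S is below eta
    it remains there, being bounded by a convex combination of values at most
    eta. *)
Lemma contracted_recursion_cvg0 S lam beta (c : R) : 0 < c ->
    (forall k, 0 <= S k) -> (forall k, 0 <= lam k) ->
    lam k @[k --> \oo] --> (0 : R) -> series lam @ \oo --> +oo ->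
    beta k @[k --> \oo] --> (0 : R) ->
    (\forall k \near \oo, S k.+1 <= (1 - c * lam k) * S k + lam k * beta k) ->
  S k @[k --> \oo] --> (0 : R).
Proof.
move=> c0 S0 lam0 lamcvg /cvgryPge lamdiv betacvg recS.
apply/cvgr0Pnorm_le => eta eta0.
pose g := c * eta / 2; have g0 : 0 < g by rewrite divr_gt0// mulr_gt0.
have ev : \forall k \near \oo, [/\ beta k <= g, c * lam k <= 1 &
    S k.+1 <= (1 - c * lam k) * S k + lam k * beta k].
  near=> k; split; last by near: k.
    apply: le_trans (ler_norm _) _; near: k.
    by move/cvgr0Pnorm_le: betacvg; apply.
  rewrite mulrC -ler_pdivlMr// div1r; apply: le_trans (ler_norm _) _; near: k.
  by move/cvgr0Pnorm_le: lamcvg; apply; rewrite invr_gt0.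
case: ev => N _ ev.
have step k : (N <= k)%N -> S k.+1 <= (1 - c * lam k) * S k + lam k * g.
  move=> /ev[bk _ Sk]; apply: le_trans Sk _; rewrite lerD2l.
  exact: ler_wpM2l.
have [K NK SK] : exists2 K, (N <= K)%N & S K <= eta.
  apply: contrapT => nK.
  have big k : (N <= k)%N -> eta < S k.
    by move=> Nk; rewrite ltNge; apply/negP => Sk; apply: nK; exists k.
  have fall j : S (N + j)%N + g * series lam (N + j)%N <= S N + g * series lam N.
    elim: j => [|j]; first by rewrite addn0.
    apply: le_trans; rewrite addnS seriesSr.
    have Nj := leq_addr j N; have := step _ Nj; have /ltW := big _ Nj.
    rewrite -subr_ge0 => /(mulr_ge0 (mulr_ge0 (ltW c0) (lam0 (N + j)%N))).
    rewrite /g; lra.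
  have [K _ /(_ (N + K)%N (leq_addl _ _))/=] :=
    lamdiv ((S N + g * series lam N + 1) / g).
  rewrite ler_pdivrMr// mulrC => h.
  have := fall K; have := S0 (N + K)%N; lra.
have stay j : S (K + j)%N <= eta.
  elim: j => [|j IH]; first by rewrite addn0.
  have Nj : (N <= K + j)%N by lia.
  have [_ cl _] := ev _ Nj; rewrite addnS; apply: le_trans (step _ Nj) _.
  have : (1 - c * lam (K + j)%N) * S (K + j)%N <= (1 - c * lam (K + j)%N) * eta.
    by rewrite ler_wpM2l// subr_ge0.
  have : 0 <= c * lam (K + j)%N * eta by rewrite !mulr_ge0// ltW.
  rewrite /g; lra.
exists K => // k /= Kk; rewrite ger0_norm//.
by have := stay (k - K)%N; rewrite subnKC.
Unshelve. all: by end_near. Qed.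

End RealSequences.
(** * Geometry of the inner product *)

Section InnerProduct.
Context (R : realType) (H : completeNormedModType R) (ip : {dot H for idfun}).
Hypothesis ip_norm : induces_norm ip.
Implicit Types (u v w z : H).

Lemma ipC u v : ip u v = ip v u.
Proof. by rewrite hermC /= expr0 mul1r. Qed.

Lemma ipDl u v w : ip (u + v) w = ip u w + ip v w.
Proof. exact: linearDl. Qed.

Lemma ipDr u v w : ip w (u + v) = ip w u + ip w v.
Proof. exact: linearDr. Qed.

Lemma ipBl u v w : ip (u - v) w = ip u w - ip v w.
Proof. exact: linearBl. Qed.

Lemma ipBr u v w : ip w (u - v) = ip w u - ip w v.
Proof. exact: linearBr. Qed.

Lemma ipNl u v : ip (- u) v = - ip u v.
Proof. exact: linearNl. Qed.

Lemma ipNr u v : ip u (- v) = - ip u v.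
Proof. exact: linearNr. Qed.

Lemma ipZl (a : R) u v : ip (a *: u) v = a * ip u v.
Proof. exact: linearZl_LR. Qed.

Lemma ipZr (a : R) u v : ip u (a *: v) = a * ip u v.
Proof. exact: linearZr_LR. Qed.

Lemma ip_sqr_norm u : ip u u = `|u| ^+ 2.
Proof.
rewrite ip_norm sqr_sqrtr//; have [->|u0] := eqVneq u 0.
  by rewrite linear0r.
by apply: ltW; exact: neq0_dnorm_gt0.
Qed.

Lemma sqr_normD u v : `|u + v| ^+ 2 = `|u| ^+ 2 + 2 * ip u v + `|v| ^+ 2.
Proof. by rewrite -!ip_sqr_norm ipDl !ipDr (ipC v u); ring. Qed.

Lemma sqr_normB u v : `|u - v| ^+ 2 = `|u| ^+ 2 - 2 * ip u v + `|v| ^+ 2.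
Proof. by rewrite -!ip_sqr_norm ipBl !ipBr (ipC v u); ring. Qed.

(** Cauchy-Schwarz is the square of the triangle inequality, which the normed
    space already provides. *)
Lemma ip_le_norm u v : ip u v <= `|u| * `|v|.
Proof.
have : `|u + v| ^+ 2 <= (`|u| + `|v|) ^+ 2.
  by rewrite ler_sqr ?nnegrE ?addr_ge0// ler_normD.
rewrite sqr_normD sqrrD; nra.
Qed.

Lemma oppr_norm_le_ip u v : - (`|u| * `|v|) <= ip u v.
Proof. by have := ip_le_norm (- u) v; rewrite ipNl normrN lerNl. Qed.

Lemma norm_ip_le u v : `|ip u v| <= `|u| * `|v|.
Proof. by rewrite ler_norml oppr_norm_le_ip ip_le_norm. Qed.

Lemma parallelogram u v :
  `|u - v| ^+ 2 + `|u + v| ^+ 2 = 2 * (`|u| ^+ 2 + `|v| ^+ 2).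
Proof. by rewrite sqr_normB sqr_normD; ring. Qed.

(** * Metric projection onto a closed convex set *)

Section Projection.
Variables (D : set H) (u : H).
Hypotheses (D0 : D !=set0) (Dcl : closed D) (Dcv : convex_set D).

Lemma convex_comb p q (t : R) : 0 <= t <= 1 -> D p -> D q -> D (p + t *: (q - p)).
Proof.
move=> /andP[t0 t1] Dp Dq.
have := Dcv (Itv01 t0 t1) (mem_set Dq) (mem_set Dp).
rewrite inE; congr (D _).
rewrite /conv/= scalerBl scale1r scalerBr.
by rewrite addrCA.
Qed.

Lemma convex_midpoint p q : D p -> D q -> D (2^-1 *: (p + q)).
Proof.
move=> Dp Dq; have : D (p + 2^-1 *: (q - p)) by apply: convex_comb => //; lra.
congr (D _); rewrite scalerBr addrCA scalerDr addrC; congr (_ + _).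
by rewrite -[X in X - _]scale1r -scalerBl; congr (_ *: _); lra.
Qed.

(** By the parallelogram law, two almost nearest points are close to each other,
    since their midpoint cannot be much nearer to u than they are.  Minimizing
    sequences are therefore Cauchy. *)
Lemma midpoint_nearest_gap p q m :
    (forall z, D z -> m <= `|u - z| ^+ 2) -> D p -> D q ->
  `|p - q| ^+ 2 <= 2 * (`|u - p| ^+ 2 - m) + 2 * (`|u - q| ^+ 2 - m).
Proof.
move=> mlb Dp Dq; have := mlb _ (convex_midpoint Dp Dq).
have := parallelogram (u - p) (u - q).
have -> : u - p - (u - q) = q - p by rewrite opprB addrC addrA subrK.
have -> : u - p + (u - q) = 2 *: (u - 2^-1 *: (p + q)).
  rewrite scalerBr scalerA mulfV ?pnatr_eq0// scale1r scaler_nat mulr2n.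
  by rewrite opprD addrACA.
rewrite normrZ exprMn (distrC q p) ger0_norm//; lra.
Qed.

Lemma nearest_point_exists :
  exists p, D p /\ forall z, D z -> `|u - p| <= `|u - z|.
Proof.
pose E := [set `|u - z| ^+ 2 | z in D].
have Einf : has_inf E.
  case: D0 => z Dz; split; first by exists (`|u - z| ^+ 2), z.
  by exists 0 => _ [y _ <-]; rewrite exprn_ge0.
have Elb z : D z -> inf E <= `|u - z| ^+ 2.
  by move=> Dz; apply: ge_inf; [exact: (proj2 Einf) | exists z].
have /choice[q qP] : forall n, exists z,
    D z /\ `|u - z| ^+ 2 < inf E + n.+1%:R^-1.
  move=> n; have n0 : 0 < n.+1%:R^-1 :> R by rewrite invr_gt0.
  by have [_ [z Dz <-] lt_z] := inf_adherent n0 Einf; exists z.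
have qD n : D (q n) by case: (qP n).
have qlt n : `|u - q n| ^+ 2 < inf E + n.+1%:R^-1 by case: (qP n).
have /cauchy_cvgP/cvg_ex[p qp] : cauchy (q n @[n --> \oo]).
  apply: cauchy_exP => e e0.
  have e4 : 0 < e ^+ 2 / 4 by rewrite divr_gt0// exprn_gt0.
  have [N _ Nlt] := near_infty_natSinv_lt (PosNum e4).
  exists (q N); exists N => // n /= Nn.
  rewrite -ball_normE/= -ltr_sqr ?nnegrE ?(ltW e0)//.
  have := midpoint_nearest_gap Elb (qD N) (qD n).
  have := Nlt N (leqnn N); have := Nlt n Nn; have := qlt N; have := qlt n.
  move: (inf E) (n.+1%:R^-1) (N.+1%:R^-1) => /= i a b; lra.
have Dp : D p by apply: closed_cvg qp => //; near do exact: qD.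
have up : `|u - p| ^+ 2 <= inf E.
  have nrm : `|u - q n| ^+ 2 @[n --> \oo] --> `|u - p| ^+ 2.
    by apply: cvgM; apply: cvg_norm; apply: cvgB => //; exact: cvg_cst.
  have bnd : inf E + n.+1%:R^-1 @[n --> \oo] --> inf E.
    rewrite -[X in _ --> X]addr0; apply: cvgD; first exact: cvg_cst.
    exact: cvg_harmonic.
  by apply: ler_cvg_to nrm bnd _; near=> n; exact: ltW.
exists p; split=> // z Dz.
by rewrite -ler_sqr ?nnegrE//; apply: le_trans up (Elb _ Dz).
Unshelve. all: by end_near. Qed.

(** Nearest points exist, so the default value in the definition of
    [metric_proj] does not occur for nonempty closed convex sets. *)
Lemma metric_projP :
  D (metric_proj D u) /\ forall z, D z -> `|u - metric_proj D u| <= `|u - z|.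
Proof. exact: (xgetPex u nearest_point_exists). Qed.

Lemma metric_proj_in : D (metric_proj D u).
Proof. by case: metric_projP. Qed.

(** If c = <u - p, z - p> were positive, moving from p towards z would come
    closer to u for small steps. *)
Lemma metric_proj_variational z :
  D z -> ip (z - metric_proj D u) (u - metric_proj D u) <= 0.
Proof.
case: metric_projP; set p := metric_proj D u => Dp pmin Dz.
rewrite leNgt; apply/negP; rewrite ipC; set c := ip _ _ => c0.
pose N := `|z - p| ^+ 2; have N0 : 0 <= N by rewrite exprn_ge0.
have cN0 : 0 < c + N by rewrite ltr_wpDr.
(* any t in ]0, 1] with t N < 2 c would do; this one satisfies t N < c and needs
   no case distinction on N *)
pose t := c / (c + N).
have t01 : 0 <= t <= 1.
  by rewrite /t divr_ge0 ?(ltW c0) ?(ltW cN0)//= ler_pdivrMr// mul1r lerDl.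
have := pmin _ (convex_comb t01 Dp Dz).
rewrite -ler_sqr ?nnegrE// opprD addrA (sqr_normB (u - p)) ipZr.
rewrite normrZ exprMn real_normK ?num_real// -/c -/N.
have tE : t * (c + N) = c by rewrite mulfVK ?gt_eqF.
have t0 : 0 < t by rewrite divr_gt0.
have -> : t ^+ 2 * N = t * c - t * (t * c) by rewrite -{1}tE; ring.
nra.
Qed.

(** Expand the square; the cross term is controlled by the variational
    characterization of the projection. *)
Lemma relaxed_proj_decrease (a : R) z : 0 <= a -> D z ->
  `|relaxed_proj a D u - z| ^+ 2 <=
    `|u - z| ^+ 2 - a * (2 - a) * `|metric_proj D u - u| ^+ 2.
Proof.
move=> a0 Dz; have := metric_proj_variational Dz; rewrite /relaxed_proj.
set p := metric_proj D u.
have -> : u + a *: (p - u) - z = (u - z) + a *: (p - u) by rewrite addrAC.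
rewrite sqr_normD ipZr normrZ exprMn real_normK ?num_real//.
have -> : u - z = (p - z) - (p - u) by rewrite opprB [RHS]addrC addrA subrK.
rewrite (ipBl (p - z)) ip_sqr_norm -(opprB p z) -(opprB p u).
rewrite ipNl ipNr opprK => h.
have := ler_wpM2l a0 h; nra.
Qed.

End Projection.

Lemma metric_proj_nonexpansive (D : set H) : D !=set0 -> closed D ->
  convex_set D -> forall u v, `|metric_proj D u - metric_proj D v| <= `|u - v|.
Proof.
move=> D0 Dcl Dcv u v.
have := metric_proj_variational u D0 Dcl Dcv (metric_proj_in v D0 Dcl Dcv).
have := metric_proj_variational v D0 Dcl Dcv (metric_proj_in u D0 Dcl Dcv).
set p := metric_proj D u; set q := metric_proj D v => hq hp.
have ipE : `|p - q| ^+ 2 <= ip (p - q) (u - v).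
  move: hp hq; rewrite -(opprB p q) ipNl -ip_sqr_norm.
  by rewrite !ipBr; lra.
have := le_trans ipE (ip_le_norm _ _).
have [->|pq] := eqVneq (p - q) 0; first by rewrite normr0.
by rewrite expr2 ler_pM2l// normr_gt0.
Qed.

(** * Strongly monotone Lipschitz operators *)

Section Operator.
Variables (F : H -> H) (L alpha : R).
Hypotheses (L_gt0 : 0 < L) (alpha_gt0 : 0 < alpha).
Hypotheses (F_lip : L.-lipschitz F) (F_mono : strongly_monotone ip alpha F).

Lemma lipschitz_norm u v : `|F u - F v| <= L * `|u - v|.
Proof. exact: (F_lip (x := (u, v))). Qed.

Lemma gradient_step_sqr (lam : R) u v : 0 <= lam ->
  `|(u - lam *: F u) - (v - lam *: F v)| ^+ 2 <=
    (1 - 2 * alpha * lam + lam ^+ 2 * L ^+ 2) * `|u - v| ^+ 2.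
Proof.
move=> lam0.
have -> : (u - lam *: F u) - (v - lam *: F v) = (u - v) - lam *: (F u - F v).
  by rewrite scalerBr !opprD addrACA.
rewrite (sqr_normB (u - v)) ipZr ipC normrZ exprMn real_normK ?num_real//.
have mono := ler_wpM2l lam0 (F_mono u v).
have lip : `|F u - F v| ^+ 2 <= L ^+ 2 * `|u - v| ^+ 2.
  rewrite -exprMn ler_sqr ?nnegrE ?mulr_ge0 ?(ltW L_gt0)//.
  exact: lipschitz_norm.
have := ler_wpM2l (sqr_ge0 lam) lip; lra.
Qed.

Lemma VI_solution_uniq C p q : VI_solution ip F C p -> VI_solution ip F C q -> p = q.
Proof.
move=> [Cp pP] [Cq qP]; have := F_mono p q; have := pP _ Cq; have := qP _ Cp.
rewrite -(opprB p q) ipNr ipBl => h1 h2 h3.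
have : alpha * `|p - q| ^+ 2 <= 0 by lra.
rewrite pmulr_rle0// => h; apply/eqP; rewrite -subr_eq0 -normr_eq0 -sqrf_eq0.
by rewrite eq_le h exprn_ge0.
Qed.

(** Solutions are the fixed points of u |-> P_C(u - g F(u)), for any g > 0.  The
    choice g = alpha / L^2 minimizes the squared Lipschitz constant
    1 - 2 alpha g + g^2 L^2 of the inner map and makes it less than 1. *)
Lemma VI_solution_exists C : C !=set0 -> closed C -> convex_set C ->
  exists p, VI_solution ip F C p.
Proof.
move=> C0 Ccl Ccv; pose g := alpha / L ^+ 2.
have g0 : 0 < g by rewrite divr_gt0// exprn_gt0.
pose G u := metric_proj C (u - g *: F u).
have GC : {homo G : u / C u >-> C u} by move=> u _; exact: metric_proj_in.
pose c := 1 - alpha ^+ 2 / L ^+ 2.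
have c1 : c < 1 by rewrite ltrBlDr ltrDl divr_gt0// exprn_gt0.
have Glip u v : `|G u - G v| <= Num.sqrt c * `|u - v|.
  apply: le_trans (metric_proj_nonexpansive C0 Ccl Ccv _ _) _.
  have := gradient_step_sqr u v (ltW g0).
  have -> : 1 - 2 * alpha * g + g ^+ 2 * L ^+ 2 = c.
    by rewrite /c /g; field; rewrite gt_eqF.
  set w := (X in `|X| ^+ 2) => h.
  rewrite -[`|w|]ger0_norm// -sqrtr_sqr -[`|u - v|]ger0_norm//.
  by rewrite -[X in _ * X]sqrtr_sqr mulrC -sqrtrM ?exprn_ge0// mulrC ler_wsqrtr.
have ctr : is_contraction (mkfun GC).
  exists (NngNum (sqrtr_ge0 c)); split => /=.
    by rewrite -sqrtr1 ltr_sqrt.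
  by move=> [u v] _ /=; exact: Glip.
have [p Cp pE] := banach_fixed_point ctr Ccl C0.
exists p; split=> // z Cz.
have := metric_proj_variational (p - g *: F p) C0 Ccl Ccv Cz.
rewrite -[metric_proj _ _]/(G p) -[G p]pE.
by rewrite addrAC subrr add0r ipNr ipZr oppr_le0 pmulr_rge0// ipC.
Qed.

End Operator.
End InnerProduct.
(** * The half-space cut off by a cutter *)

Section CutHalfspace.
Context (R : realType) (H : completeNormedModType R) (ip : {dot H for idfun}).
Hypothesis ip_norm : induces_norm ip.
Implicit Types (U : H -> H) (u y z : H).

Lemma cut_halfspace_neq0 U u : cut_halfspace ip U u !=set0.
Proof. by exists (U u); rewrite /cut_halfspace/= subrr linear0l. Qed.

Lemma cut_halfspace_closed U u : closed (cut_halfspace ip U u).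
Proof.
set b := u - U u; pose f z := ip (z - U u) b.
have f_cont : continuous f.
  move=> z; apply/cvgrPdist_le => e e0; near=> y.
  have -> : f z - f y = ip (z - y) b.
    by rewrite /f -ipBl opprB addrA subrK.
  apply: le_trans (norm_ip_le ip_norm _ _) _.
  have b0 : 0 < 1 + `|b| by rewrite ltr_pwDl.
  have zy : `|z - y| <= e / (1 + `|b|).
    by near: y; apply: cvgr_dist_le; [exact: cvg_id | rewrite divr_gt0].
  move: zy; rewrite ler_pdivlMr//; apply: le_trans.
  by rewrite ler_wpM2l// lerDr.
exact: (proj1 (continuous_closedP f) f_cont _ (@closed_le _ 0)).
Unshelve. all: by end_near. Qed.

Lemma cut_halfspace_convex U u : convex_set (cut_halfspace ip U u).
Proof.
move=> p q t; rewrite !inE /cut_halfspace/= => hp hq.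
have -> : (conv t p q : H) - U u =
    t%:num *: (p - U u) + (1 - t%:num) *: (q - U u).
  rewrite /conv/= !scalerBr addrACA -opprD -scalerDl; congr (_ - _).
  by rewrite addrC subrK scale1r.
rewrite (ipDl ip) !ipZl.
have t0 : 0 <= t%:num :> R by [].
have t1 : 0 <= 1 - t%:num :> R by rewrite subr_ge0.
nra.
Qed.

Lemma Fix_sub_cut_halfspace U u : cutter ip U -> Fix U `<=` cut_halfspace ip U u.
Proof. by move=> [_ cutU] z; exact: cutU. Qed.

(** The point U u is the projection of u onto the half-space, so |U u - u| is
    at most the distance from u to any point of the half-space, in particular to
    the projection of y. *)
Lemma cutter_residual_le U u y :
  `|U u - u| <= `|y - u| + `|metric_proj (cut_halfspace ip U u) y - y|.
Proof.
have := metric_proj_in ip_norm y (cut_halfspace_neq0 U u)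
  (@cut_halfspace_closed U u) (@cut_halfspace_convex U u).
set w := metric_proj _ y; rewrite /cut_halfspace/= => hw.
have uw : `|u - U u| <= `|u - w|.
  have [->|u0] := eqVneq (u - U u) 0; first by rewrite normr0.
  rewrite -(ler_pM2r (x := `|u - U u|)) ?normr_gt0//.
  apply: le_trans (ip_le_norm ip_norm _ _).
  rewrite -expr2 -(ip_sqr_norm ip_norm).
  have -> : u - w = (u - U u) - (w - U u) by rewrite opprB addrA subrK.
  by rewrite [leRHS](ipBl ip); lra.
rewrite distrC; apply: le_trans uw _.
have -> : u - w = - ((y - u) + (w - y)) by rewrite (addrC (y - u)) addrA subrK opprB.
by rewrite normrN ler_normD.
Qed.

(** The factor a (2 - a) is at least eps^2 because both a and 2 - a are at least
    eps. *)
Lemma cutter_step_decrease U u y z (a eps : R) : cutter ip U -> Fix U z ->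
    0 < eps -> eps <= a <= 2 - eps ->
  `|relaxed_proj a (cut_halfspace ip U u) y - z| ^+ 2 <=
    `|y - z| ^+ 2
      - eps ^+ 2 * `|metric_proj (cut_halfspace ip U u) y - y| ^+ 2.
Proof.
move=> cutU Uz eps0 /andP[ea a2]; have a0 := le_trans (ltW eps0) ea.
apply: le_trans (relaxed_proj_decrease ip_norm _ (cut_halfspace_neq0 U u)
  (@cut_halfspace_closed U u) (@cut_halfspace_convex U u) a0
  (Fix_sub_cut_halfspace u cutU Uz)) _.
rewrite lerD2l lerN2 ler_wpM2r ?exprn_ge0//; nra.
Qed.

End CutHalfspace.

(** * The outer approximation method *)

Section OuterApproximation.
Context (R : realType) (H : completeNormedModType R) (ip : {dot H for idfun}).
Hypothesis ip_norm : induces_norm ip.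
Variables (F : H -> H) (L alpha : R).
Hypotheses (L_gt0 : 0 < L) (alpha_gt0 : 0 < alpha).
Hypotheses (F_lip : L.-lipschitz F) (F_mono : strongly_monotone ip alpha F).

(** Outside z, the step contracts distances to z by 1 - lam c / 2, where
    c = 2 alpha - mu L^2 > 0 and sqrt(1 - t) <= 1 - t / 2; the displacement
    lam |F z| of z is absorbed since |F z| <= c B / 2. *)
Lemma gradient_step_ball (mu lam B : R) z u : mu < 2 * alpha / L ^+ 2 ->
    0 <= lam <= mu -> 2 * `|F z| <= (2 * alpha - mu * L ^+ 2) * B ->
    mu * `|F z| <= B -> `|u - z| <= B ->
  `|u - lam *: F u - z| <= B.
Proof.
rewrite ltr_pdivlMr ?exprn_gt0// => mulL /andP[lam0 lam_mu].
set c := 2 * alpha - mu * L ^+ 2 => Bc Bmu uz.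
have c0 : 0 < c by rewrite subr_gt0.
(* at u = z the sign of 1 - lam c is unknown, and the bound on mu |F z| takes
   over *)
have [->|u_neq] := eqVneq u z.
  rewrite addrAC subrr add0r normrN normrZ ger0_norm//.
  exact: le_trans (ler_wpM2r _ lam_mu) Bmu.
have M0 : 0 < `|u - z| by rewrite normr_gt0 subr_eq0.
pose N := `|(u - lam *: F u) - (z - lam *: F z)|; have N0 : 0 <= N by exact: normr_ge0.
have N2 : N ^+ 2 <= (1 - lam * c) * `|u - z| ^+ 2.
  apply: le_trans (gradient_step_sqr ip_norm L_gt0 F_lip F_mono u z lam0) _.
  rewrite ler_wpM2r ?exprn_ge0// /c.
  have := ler_wpM2l (mulr_ge0 lam0 (sqr_ge0 L)) lam_mu; lra.
(* a nonnegative square bounded by (1 - lam c) |u - z|^2 with u != z *)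
have lc : 0 <= 1 - lam * c.
  have := le_trans (sqr_ge0 N) N2; rewrite pmulr_lge0// exprn_gt0//.
have NM : N <= (1 - lam * c / 2) * `|u - z|.
  rewrite -ler_sqr ?nnegrE ?mulr_ge0//; last by lra.
  apply: le_trans N2 _; rewrite exprMn ler_wpM2r ?exprn_ge0//.
  have := sqr_ge0 (lam * c / 2); nra.
have -> : u - lam *: F u - z = ((u - lam *: F u) - (z - lam *: F z)) - lam *: F z.
  by rewrite opprB addrA addrAC addrK.
apply: le_trans (ler_normB _ _) _; rewrite -/N normrZ (ger0_norm lam0).
have lc2 : 0 <= 1 - lam * c / 2 by lra.
have := ler_wpM2l lc2 uz; have := ler_wpM2l lam0 Bc; lra.
Qed.

Variable C : set H.
Hypotheses (C_neq0 : C !=set0) (C_closed : closed C) (C_convex : convex_set C).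
Variable T : nat -> H -> H.
Hypotheses (T_cutter : forall k, cutter ip (T k))
  (C_Fix : forall k, C `<=` Fix (T k)).
Variable lambda : nat -> R.
Hypothesis lambda_ge0 : forall k, 0 <= lambda k.
Variable eps : R.
Hypothesis eps_gt0 : 0 < eps.
Variable a : nat -> R.
Hypothesis a_bnd : forall k, eps <= a k <= 2 - eps.
Variable x : nat -> H.
Hypothesis x_rec : forall k, x k.+1 =
  relaxed_proj (a k) (cut_halfspace ip (T k) (x k)) (x k - lambda k *: F (x k)).

Let y k := x k - lambda k *: F (x k).
Let rho k := `|metric_proj (cut_halfspace ip (T k) (x k)) (y k) - y k|.

Lemma iterate_decrease z k : C z ->
  `|x k.+1 - z| ^+ 2 <= `|y k - z| ^+ 2 - eps ^+ 2 * rho k ^+ 2.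
Proof.
move=> Cz; rewrite x_rec.
exact: (cutter_step_decrease ip_norm _ _ (T_cutter k) (@C_Fix k z Cz) eps_gt0 (a_bnd k)).
Qed.

Lemma iterate_le z k : C z -> `|x k.+1 - z| <= `|y k - z|.
Proof.
move=> /iterate_decrease - /(_ k) h; rewrite -ler_sqr ?nnegrE//.
by apply: le_trans h _; rewrite lerBlDr lerDl mulr_ge0 ?sqr_ge0.
Qed.

Lemma gradient_sqr_norm z k : `|y k - z| ^+ 2 =
  `|x k - z| ^+ 2 - 2 * lambda k * ip (F (x k)) (x k - z)
    + lambda k ^+ 2 * `|F (x k)| ^+ 2.
Proof.
rewrite /y addrAC (sqr_normB ip_norm (x k - z)) ipZr (ipC ip) normrZ exprMn.
by rewrite real_normK ?num_real// mulrA.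
Qed.

(** The radius B is chosen large enough for [gradient_step_ball], and the cutter
    step does not increase the distance to z in C. *)
Lemma iterates_bounded (mu : R) : mu < 2 * alpha / L ^+ 2 ->
    (\forall k \near \oo, lambda k <= mu) ->
  exists M, forall k, `|x k| <= M.
Proof.
move=> mulL [N _ lam_mu]; have [z Cz] := C_neq0.
have mu0 : 0 <= mu := le_trans (lambda_ge0 N) (lam_mu N (leqnn N)).
pose c := 2 * alpha - mu * L ^+ 2.
have c0 : 0 < c by rewrite subr_gt0 -ltr_pdivlMr// exprn_gt0.
pose B := `|x N - z| + 2 * `|F z| / c + mu * `|F z|.
have B1 : 0 <= 2 * `|F z| / c by rewrite divr_ge0 ?(ltW c0)// mulr_ge0.
have B2 : 0 <= mu * `|F z| by rewrite mulr_ge0.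
have B3 : 0 <= `|x N - z| by [].
have ball j : `|x (N + j)%N - z| <= B.
  elim: j => [|j IH]; first by rewrite addn0 /B; lra.
  rewrite addnS; apply: le_trans (iterate_le _ Cz) _.
  apply: gradient_step_ball mulL _ _ _ IH; rewrite ?lambda_ge0 -?/c.
  - by rewrite lam_mu//= leq_addr.
  - by rewrite [leRHS]mulrC -ler_pdivrMr// /B; lra.
  - by rewrite /B; lra.
apply: (@bounded_of_eventually _ _ _ (B + `|z|)); exists N => // k /= Nk.
rewrite -(subrK z (x k)); apply: le_trans (ler_normD _ _) _.
by rewrite lerD2r -(subnKC Nk).
Qed.

Hypothesis lambda_cvg0 : lambda k @[k --> \oo] --> (0 : R).

Lemma iterates_bounded_vanishing : exists M, forall k, `|x k| <= M.
Proof.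
have m0 : 0 < alpha / L ^+ 2 by rewrite divr_gt0// exprn_gt0.
apply: (@iterates_bounded (alpha / L ^+ 2)).
  by rewrite -mulrA mulr_natl mulr2n ltrDl.
near=> k; apply: le_trans (ler_norm _) _; near: k.
by move/cvgr0Pnorm_le: lambda_cvg0; apply.
Unshelve. all: by end_near. Qed.

Lemma gradients_bounded : exists G, forall k, `|F (x k)| <= G.
Proof.
have [M xM] := iterates_bounded_vanishing.
exists (L * (M + `|x 0|) + `|F (x 0)|) => k.
rewrite -(subrK (F (x 0)) (F (x k))); apply: le_trans (ler_normD _ _) _.
rewrite lerD2r; apply: le_trans (lipschitz_norm F_lip _ _) _.
rewrite ler_pM2l//; apply: le_trans (ler_normB _ _) _.
by rewrite lerD2r.
Qed.

Lemma dist_le u z : C z -> dist u C <= `|u - z|.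
Proof.
move=> Cz; rewrite /dist distrC.
by case: (metric_projP ip_norm u C_neq0 C_closed C_convex) => _; apply.
Qed.

Variable s : nat.
Hypothesis s_gt0 : (0 < s)%N.
Hypothesis regular : forall n : nat -> nat, increasing_seq n ->
  residual_sum T x s n k @[k --> \oo] --> (0 : R) ->
  dist (x (n k)) C @[k --> \oo] --> (0 : R).

Lemma large_residual (delta : R) k : delta < residual_sum T x s id k ->
  exists l, [/\ (l < s)%N, (l <= k)%N &
    delta / s%:R < `|T (k - l)%N (x (k - l)%N) - x (k - l)%N|].
Proof.
rewrite ltNge => /negP big; apply: contrapT => small; apply: big.
have s0 : 0 < s%:R :> R by rewrite ltr0n.
have [d0|d0] := leP 0 delta; last first.
  exfalso; apply: small; exists 0%N; split=> //.
  by apply: (lt_le_trans _ (normr_ge0 _)); rewrite pmulr_llt0// invr_gt0.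
have -> : delta = \sum_(l < s) delta / s%:R.
  by rewrite sumr_const card_ord -[RHS]mulr_natr divfK// gt_eqF.
rewrite /residual_sum big_mkcond; apply: ler_sum => l _.
case: ifP => lk; last by rewrite divr_ge0.
by rewrite leNgt; apply/negP => ?; apply: small; exists l.
Qed.

(** The squared distance to C satisfies [quasi_decreasing_cvg0]: comparison with
    the projection of x_k bounds the next distance, and a residual larger than
    delta / s leaves at least half of it to the projection step once
    lambda_k |F(x_k)| is below delta / (2 s). *)
Lemma dist_cvg0 : dist (x k) C @[k --> \oo] --> (0 : R).
Proof.
have [M xM] := iterates_bounded_vanishing; have [G FG] := gradients_bounded.
have G0 : 0 <= G := le_trans (normr_ge0 _) (FG 0).
have [z Cz] := C_neq0; pose Q := M + `|z|.
have d0 u : 0 <= dist u C by rewrite /dist.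
have dQ k : dist (x k) C <= Q.
  apply: le_trans (dist_le _ Cz) _; apply: le_trans (ler_normB _ _) _.
  by rewrite lerD2r.
suff D0 : dist (x k) C ^+ 2 @[k --> \oo] --> (0 : R).
  apply/cvgr0Pnorm_le => eta eta0; near=> k.
  rewrite ger0_norm// -ler_sqr ?nnegrE ?(ltW eta0)//.
  apply: le_trans (ler_norm _) _; near: k.
  by move/cvgr0Pnorm_le: D0; apply; rewrite exprn_gt0.
apply: (@quasi_decreasing_cvg0 _ _ (fun k => eps ^+ 2 * rho k ^+ 2)
  (fun k => lambda k * (2 * G * Q) + lambda k ^+ 2 * G ^+ 2) s (Q ^+ 2)).
- move=> k; rewrite exprn_ge0//= ler_sqr ?nnegrE//.
  exact: le_trans (d0 _) (dQ k).
- by move=> k; rewrite mulr_ge0 ?sqr_ge0.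
- rewrite -[X in _ --> X](_ : 0 * (2 * G * Q) + 0 ^+ 2 * G ^+ 2 = 0).
    by apply: cvgD; apply: cvgM; try exact: cvg_cst; [|apply: cvgM].
  by rewrite mul0r expr0n mul0r addr0.
- near=> k; set p := metric_proj C (x k).
  have Cp : C p by exact: (metric_proj_in ip_norm).
  have := iterate_decrease k Cp; rewrite gradient_sqr_norm.
  have : dist (x k.+1) C ^+ 2 <= `|x k.+1 - p| ^+ 2.
    by rewrite ler_sqr ?nnegrE// dist_le.
  have pE : `|x k - p| = dist (x k) C by rewrite distrC.
  have := oppr_norm_le_ip ip_norm (F (x k)) (x k - p); rewrite pE => h1.
  have h2 : `|F (x k)| * dist (x k) C <= G * Q by rewrite ler_pM.
  have h3 : `|F (x k)| ^+ 2 <= G ^+ 2 by rewrite ler_sqr ?nnegrE.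
  have h4 : - (G * Q) <= ip (F (x k)) (x k - p) by lra.
  have := ler_wpM2l (lambda_ge0 k) h4.
  have := ler_wpM2l (sqr_ge0 (lambda k)) h3; lra.
move=> eta eta0; have s0 : 0 < s%:R :> R by rewrite ltr0n.
have se0 : 0 < Num.sqrt eta by rewrite sqrtr_gt0.
have res0 k : 0 <= residual_sum T x s id k by exact: sumr_ge0.
have [delta delta0 ev] :=
  @uniform_of_subsequential _ _ (fun k => dist (x k) C) res0 regular _ se0.
pose sg := delta / s%:R / 2; have sg0 : 0 < sg by rewrite !divr_gt0.
exists (eps ^+ 2 * sg ^+ 2); first by rewrite mulr_gt0// exprn_gt0.
(* G may vanish, whence the denominator G + 1 *)
have G10 : 0 < G + 1 by rewrite ltr_wpDl.
have [N _ lamN] : \forall k \near \oo, `|lambda k| <= sg / (G + 1).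
  by move/cvgr0Pnorm_le: lambda_cvg0; apply; rewrite divr_gt0.
near=> k; have [rk|/large_residual[l [ls lk tl]]] :=
  leP (residual_sum T x s id k) delta.
  left; rewrite -(sqr_sqrtr (ltW eta0)) ler_sqr ?nnegrE ?sqrtr_ge0//.
  by move: rk; near: k.
right; exists l; split=> //; rewrite ler_wpM2l ?exprn_ge0 ?(ltW eps_gt0)//.
rewrite ler_sqr ?nnegrE ?(ltW sg0)//; last exact: normr_ge0.
have Nkl : (N <= k - l)%N.
  have : (N + s <= k)%N by near: k; exact: nbhs_infty_ge.
  lia.
have := cutter_residual_le ip_norm (T (k - l)%N) (x (k - l)%N) (y (k - l)%N).
rewrite -/(rho _) {1}/y addrAC subrr add0r normrN normrZ.
have := lamN _ Nkl; rewrite /= ler_pdivlMr// => h.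
have : `|lambda (k - l)%N| * `|F (x (k - l)%N)| <= sg.
  apply: le_trans h; rewrite ler_wpM2l//; apply: le_trans (FG _) _.
  by rewrite lerDl.
move: tl; rewrite /sg; lra.
Unshelve. all: by end_near. Qed.

(** Comparison of x_{k+1} with the solution xs gives a recursion of the form
    treated in [contracted_recursion_cvg0], with c = 2 alpha and
    beta_k = 2 |F(xs)| d(x_k, C) + lambda_k G^2. *)
Lemma iterates_cvg_VI : series lambda @ \oo --> +oo ->
  exists2 xs : H, unique (VI_solution ip F C) xs & x k @[k --> \oo] --> xs.
Proof.
move=> lam_div; have [G FG] := gradients_bounded.
have G0 : 0 <= G := le_trans (normr_ge0 _) (FG 0).
have [xs xsP] := VI_solution_exists ip_norm L_gt0 alpha_gt0 F_lip F_mono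
  C_neq0 C_closed C_convex.
exists xs.
  by split=> [|q qP]; [exact: xsP | exact: (VI_solution_uniq alpha_gt0 F_mono xsP qP)].
have [Cxs xsmin] := xsP.
have c0 : 0 < 2 * alpha by rewrite mulr_gt0.
suff S0 : `|x k - xs| ^+ 2 @[k --> \oo] --> (0 : R).
  apply/cvgrPdist_le => eta eta0; near=> k.
  rewrite distrC -ler_sqr ?nnegrE ?(ltW eta0)//.
  apply: le_trans (ler_norm _) _; near: k.
  by move/cvgr0Pnorm_le: S0; apply; rewrite exprn_gt0.
pose beta k := 2 * `|F xs| * dist (x k) C + lambda k * G ^+ 2.
apply: (@contracted_recursion_cvg0 _ _ lambda beta _ c0) => //.
- rewrite -[X in _ --> X](_ : 2 * `|F xs| * 0 + 0 * G ^+ 2 = 0).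
    by apply: cvgD; apply: cvgM; try exact: cvg_cst; [exact: dist_cvg0|].
  by rewrite mulr0 mul0r addr0.
near=> k; have : `|x k.+1 - xs| ^+ 2 <= `|y k - xs| ^+ 2.
  by rewrite ler_sqr ?nnegrE// iterate_le.
rewrite gradient_sqr_norm.
pose p := metric_proj C (x k).
have Cp : C p by exact: (metric_proj_in ip_norm).
have h1 : - (`|F xs| * dist (x k) C) <= ip (F xs) (x k - xs).
  have -> : x k - xs = (x k - p) + (p - xs) by rewrite addrA subrK.
  rewrite [leRHS](ipDr ip); have := xsmin _ Cp.
  have := oppr_norm_le_ip ip_norm (F xs) (x k - p).
  rewrite (distrC (x k)) -/(dist _ _); lra.
have := F_mono (x k) xs; rewrite (ipBl ip) => h2.
have h3 : `|F (x k)| ^+ 2 <= G ^+ 2 by rewrite ler_sqr ?nnegrE.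
have h4 : alpha * `|x k - xs| ^+ 2 - `|F xs| * dist (x k) C <=
  ip (F (x k)) (x k - xs) by lra.
have := ler_wpM2l (lambda_ge0 k) h4.
have := ler_wpM2l (sqr_ge0 (lambda k)) h3; rewrite /beta; lra.
Unshelve. all: by end_near. Qed.

End OuterApproximation.

(* The step-size condition in the first conjunct is not in the source: without
   some such condition the sequence need not be bounded (H = R, F = Id,
   C = {0}, T_k = Id, lambda_k = 3 gives x_k = (-2)^k x_0). It is implied by
   lambda_k --> 0. *)
Theorem theorem3p1 (R : realType) (H : completeNormedModType R)
  (ip : {dot H for idfun}) (ip_norm : induces_norm ip)
  (F : H -> H) (L alpha : R) (L_gt0 : 0 < L) (alpha_gt0 : 0 < alpha)
  (F_lip : L.-lipschitz F) (F_mono : strongly_monotone ip alpha F)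
  (C : set H) (C_neq0 : C !=set0) (C_closed : closed C) (C_convex : convex_set C)
  (T : nat -> H -> H) (T_cutter : forall k, cutter ip (T k))
  (C_Fix : forall k, C `<=` Fix (T k))
  (lambda : nat -> R) (lambda_ge0 : forall k, 0 <= lambda k)
  (eps : R) (eps_gt0 : 0 < eps)
  (a : nat -> R) (a_bnd : forall k, eps <= a k <= 2 - eps)
  (x : nat -> H)
  (x_rec : forall k, x k.+1 =
     relaxed_proj (a k) (cut_halfspace ip (T k) (x k))
       (x k - lambda k *: F (x k))) :
  ((exists2 mu : R, mu < 2 * alpha / L ^+ 2
                  & \forall k \near \oo, lambda k <= mu) ->
   [bounded x k | k in [set: nat]])
  /\
  (forall s : nat, (1 <= s)%N ->
   lambda k @[k --> \oo] --> (0 : R) ->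
   (forall n : nat -> nat, increasing_seq n ->
      residual_sum T x s n k @[k --> \oo] --> (0 : R) ->
      dist (x (n k)) C @[k --> \oo] --> (0 : R)) ->
   dist (x k) C @[k --> \oo] --> (0 : R)
   /\
   (series lambda @ \oo --> +oo ->
    exists2 xs : H, unique (VI_solution ip F C) xs
                  & x k @[k --> \oo] --> xs)).
Proof.
split.
  move=> [mu mulL lam_mu].
  have [M xM] := iterates_bounded ip_norm L_gt0 F_lip F_mono C_neq0
    T_cutter C_Fix lambda_ge0 eps_gt0 a_bnd x_rec mulL lam_mu.
  exists M; split; first exact: num_real.
  by move=> B /ltW MB k _; exact: le_trans (xM k) MB.
move=> s s1 lam0 regular; split.
  exact: (dist_cvg0 ip_norm L_gt0 alpha_gt0 F_lip F_mono C_neq0 C_closed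
    C_convex T_cutter C_Fix lambda_ge0 eps_gt0 a_bnd x_rec lam0 s1 regular).
exact: (iterates_cvg_VI ip_norm L_gt0 alpha_gt0 F_lip F_mono C_neq0 C_closed
  C_convex T_cutter C_Fix lambda_ge0 eps_gt0 a_bnd x_rec lam0 s1 regular).
Qed.
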